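(* An operator system $\mathcal S$ is one-dimensional if and only if for every operator system $\mathcal T$ and every kernel $\mathcal J$ in $\mathcal T$, every unital completely positive map $\varphi:\mathcal S\to\mathcal T/\mathcal J$ lifts to a completely positive map $\tilde\varphi:\mathcal S\to\mathcal T$ (i.e. $\tilde\varphi$ composed with the quotient map $\mathcal T\to\mathcal T/\mathcal J$ equals $\varphi$).
   Context: Operator systems are abstract (Choi–Effros) operator systems, not assumed complete. A kernel $\mathcal J$ in an operator system $\mathcal T$ is a subspace that is the kernel of a unital completely positive map from $\mathcal T$ to another operator system. The quotient operator system $\mathcal T/\mathcal J$ has order unit $1_{\mathcal T}+\mathcal J$ and cones $M_n(\mathcal T/\mathcal J)^+=\{[x_{i,j}+\mathcal J]:\forall\varepsilon>0\ \exists k_{i,j}\in\mathcal J,\ \varepsilon I_n\otimes1_{\mathcal T}+[x_{i,j}+k_{i,j}]\in M_n(\mathcal T)^+\}$. *)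

(* Defs.v *)
From HB Require Import structures.
From mathcomp Require Import all_boot all_order all_algebra generic_quotient.
From mathcomp Require Import complex reals.

Set Implicit Arguments.
Unset Strict Implicit.
Unset Printing Implicit Defensive.

Import Order.TTheory GRing.Theory Num.Theory.
Local Open Scope ring_scope.
Local Open Scope quotient_scope.

Local Notation "x %:C" := (real_complex _ x) : ring_scope.

Definition mxadj (V : Type) (s : V -> V) n (A : 'M[V]_n) : 'M[V]_n :=
  \matrix_(i, j) s (A j i).

(* X^* A X, for a scalar matrix X *)
Definition mxcongr (R : realType) (V : lmodType R[i]) m n
    (X : 'M[R[i]]_(m, n)) (A : 'M[V]_m) : 'M[V]_n :=
  \matrix_(i, j) \sum_k \sum_l ((X k i)^* * X l j) *: A k l.

(* Complex *-vector spaces with an Archimedean matrix order and an Archimedean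
   matrix order unit, in the sense of Choi and Effros; no norm-completeness is
   required. [(r%:C *: e)%:M] is the matrix r I_n (x) e. The last axiom only
   excludes the zero space. The matrix size n = 0 is allowed, but the axioms
   force the cone of 'M[V]_0 to be {0}. *)
HB.mixin Record isOperatorSystem (R : realType) V of GRing.Lmodule R[i] V := {
  star : V -> V;
  mxpos : forall n, 'M[V]_n -> Prop;
  os_unit : V;
  starK : involutive star;
  star_conjlinear : forall (a : R[i]) x y,
    star (a *: x + y) = a^* *: star x + star y;
  mxpos_adj : forall n (A : 'M[V]_n), mxpos n A -> mxadj star A = A;
  mxposD : forall n (A B : 'M[V]_n), mxpos n A -> mxpos n B -> mxpos n (A + B);
  mxposZ : forall n (r : R) (A : 'M[V]_n), 0 <= r ->
    mxpos n A -> mxpos n (map_mx ( *:%R r%:C) A);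
  mxpos_proper : forall n (A : 'M[V]_n), mxpos n A -> mxpos n (- A) -> A = 0;
  mxpos_congr : forall m n (X : 'M[R[i]]_(m, n)) (A : 'M[V]_m),
    mxpos m A -> mxpos n (mxcongr X A);
  star_unit : star os_unit = os_unit;
  os_order_unit : forall n (A : 'M[V]_n), mxadj star A = A ->
    exists2 r : R, 0 < r & mxpos n ((r%:C *: os_unit)%:M + A);
  os_archimedean : forall n (A : 'M[V]_n),
    (forall r : R, 0 < r -> mxpos n ((r%:C *: os_unit)%:M + A)) -> mxpos n A;
  os_unit_neq0 : os_unit != 0
}.

#[short(type="opsysType")]
HB.structure Definition OperatorSystem (R : realType) :=
  { V of isOperatorSystem R V & GRing.Lmodule R[i] V }.

Arguments os_unit {R} V : rename.
Arguments mxpos_adj {R s} {n} A _.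
Arguments mxposD {R s} {n} A B _ _.
Arguments mxposZ {R s} {n} r A _ _.
Arguments mxpos_proper {R s} {n} A _ _.
Arguments os_order_unit {R s} {n} A _.
Arguments os_archimedean {R s} {n} A _.
Arguments mxpos_congr {R s} {m n} X A _.

Section Maps.
Variables (R : realType) (S T : opsysType R).

Definition completely_positive (f : {linear S -> T}) : Prop :=
  forall n (A : 'M[S]_n), mxpos n A -> mxpos n (map_mx f A).

Definition ucp (f : {linear S -> T}) : Prop :=
  completely_positive f /\ f (os_unit S) = os_unit T.

End Maps.

(* Membership is boolean so that the library's quotients Quotient.quot apply;
   classically this is no restriction on the subspace. *)
Record opkernel (R : realType) (T : opsysType R) := OpKernel {
  opkernel_pred :> {pred T};
  opkernelP : exists (U : opsysType R) (f : {linear T -> U}),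
    ucp f /\ forall x, (x \in opkernel_pred) = (f x == 0)
}.

(* A linear isomorphism onto C^1, as in the library's axiom for finite
   dimension. *)
Definition one_dimensional (R : realType) (V : lmodType R[i]) : Prop :=
  exists2 f : V -> 'rV[R[i]]_1, linear f & bijective f.

Section StarTheory.
Variables (R : realType) (T : opsysType R).
Implicit Types (x y : T).

Lemma starD x y : star (x + y) = star x + star y.
Proof. by have := star_conjlinear 1 x y; rewrite rmorph1 !scale1r. Qed.

Lemma star0 : star (0 : T) = 0.
Proof. by apply: (addrI (star 0)); rewrite -starD !addr0. Qed.

Lemma starZ a x : star (a *: x) = a^* *: star x.
Proof. by have := star_conjlinear a x 0; rewrite star0 !addr0. Qed.

Lemma starN x : star (- x) = - star x.
Proof. by rewrite -scaleN1r starZ rmorphN rmorph1 scaleN1r. Qed.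

End StarTheory.

Lemma conj_real (R : realType) (r : R) : (r%:C)^* = r%:C :> R[i].
Proof. exact: conjc_real. Qed.

Section MatrixTheory.
Variables (R : realType) (T : opsysType R).

Local Notation I_ r := ((r%:C *: os_unit T)%:M).

Lemma mxadjD n (A B : 'M[T]_n) :
  mxadj star (A + B) = mxadj star A + mxadj star B.
Proof. by apply/matrixP => i j; rewrite !mxE starD. Qed.

Lemma mxadjK n : involutive (@mxadj T star n).
Proof. by move=> A; apply/matrixP => i j; rewrite !mxE starK. Qed.

Lemma mxadj_unit n (r : R) : mxadj star (I_ r : 'M[T]_n) = I_ r.
Proof.
apply/matrixP => i j; rewrite !mxE eq_sym; case: eqP => _.
  by rewrite !mulr1n starZ star_unit conj_real.
by rewrite star0.
Qed.

Lemma unit_mxD n (r s : R) : I_ (r + s) = I_ r + I_ s :> 'M[T]_n.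
Proof. by rewrite rmorphD scalerDl raddfD. Qed.

Lemma unit_mxZ n (r s : R) :
  map_mx ( *:%R r%:C) (I_ s) = I_ (r * s) :> 'M[T]_n.
Proof.
apply/matrixP => i j; rewrite !mxE; case: eqP => _.
  by rewrite !mulr1n scalerA rmorphM.
by rewrite scaler0.
Qed.

Lemma mxpos_unit n (r : R) : 0 < r -> mxpos n (I_ r : 'M[T]_n).
Proof.
move=> r0; have h0 : mxadj star (0 : 'M[T]_n) = 0.
  by apply/matrixP => i j; rewrite !mxE star0.
have [s s0] := os_order_unit _ h0; rewrite addr0.
have rs : 0 <= r / s by rewrite ltW // divr_gt0.
by move/(mxposZ _ _ rs); rewrite unit_mxZ divfK // gt_eqF.
Qed.

Lemma mxpos0 n : mxpos n (0 : 'M[T]_n).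
Proof. by apply: os_archimedean => r r0; rewrite addr0; exact: mxpos_unit. Qed.

Lemma mxcongrD m n (X : 'M[R[i]]_(m, n)) (A B : 'M[T]_m) :
  mxcongr X (A + B) = mxcongr X A + mxcongr X B.
Proof.
apply/matrixP => i j; rewrite !mxE -big_split; apply: eq_bigr => k _.
rewrite -big_split; apply: eq_bigr => l _; by rewrite !mxE scalerDr.
Qed.

Lemma mxcongrZ m n (X : 'M[R[i]]_(m, n)) a (A : 'M[T]_m) :
  mxcongr X (map_mx ( *:%R a) A) = map_mx ( *:%R a) (mxcongr X A).
Proof.
apply/matrixP => i j; rewrite !mxE scaler_sumr; apply: eq_bigr => k _.
rewrite scaler_sumr; apply: eq_bigr => l _.
by rewrite !mxE !scalerA mulrC.
Qed.

End MatrixTheory.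

Section PositiveMaps.
Variables (R : realType) (T U : opsysType R) (f : {linear T -> U}).
Hypothesis f_ucp : ucp f.

Lemma ucp_star x : f (star x) = star (f x).
Proof.
have [f_cp f1] := f_ucp.
have herm (h : T) : star h = h -> star (f h) = f h.
  move=> hh; have hA : mxadj star (h%:M : 'M[T]_1) = h%:M.
    by apply/matrixP => i j; rewrite !mxE eq_sym !ord1 eqxx mulr1n.
  have [r r0 /f_cp/(mxpos_adj _)/matrixP/(_ 0 0)] := os_order_unit _ hA.
  rewrite !mxE eqxx !mulr1n linearD linearZ /= f1 starD starZ star_unit conj_real.
  by move/addrI.
have i2 : (2 : R[i]) \is a GRing.unit by rewrite unitfE pnatr_eq0.
pose h := x + star x; pose k := 'i%C *: (x - star x).
have hh : star h = h by rewrite /h starD starK addrC.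
have kk : star k = k.
  rewrite /k starZ starD starN starK -opprB scalerN -scaleNr.
  by congr (_ *: _); apply/eqP; rewrite eq_complex /= oppr0 opprK !eqxx.
have ii : 'i%C * 'i = -1 :> R[i] by have := sqr_i R; rewrite expr2.
have e1 : 2 *: x = h - 'i%C *: k.
  rewrite /h /k scalerA ii scaleN1r opprK addrACA subrr addr0.
  by rewrite scaler_nat mulr2n.
have e2 : 2 *: star x = h + 'i%C *: k.
  by rewrite /h /k scalerA ii scaleN1r opprB [x + _]addrC addrACA subrr addr0 scaler_nat mulr2n.
have : 2 *: f (star x) = 2 *: star (f x).
  have c2 : 2^* = 2 :> R[i] by rewrite rmorph_nat.
  clearbody h k.
  transitivity (star (f (2 *: x))); last by rewrite linearZ starZ /= c2.
  rewrite -[LHS]linearZ e2 e1 linearD linearB !linearZ /=.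
  rewrite scalerN starD starN starZ (herm _ hh) (herm _ kk).
  rewrite -scaleNr; congr (_ + _ *: _).
  by apply/eqP; rewrite eq_complex /= oppr0 opprK !eqxx.
by move/(congr1 ( *:%R 2^-1)); rewrite !scalerA mulVr // !scale1r.
Qed.

End PositiveMaps.

Section Quotient.
Variables (R : realType) (T : opsysType R) (J : opkernel T).

Lemma opkernel_submod : submod_closed (opkernel_pred J).
Proof.
have [U [f [_ Jf]]] := opkernelP J.
split=> [|a x y]; rewrite !Jf ?linear0 // => /eqP fx /eqP fy.
by rewrite linearP fx fy scaler0 addr0.
Qed.

HB.instance Definition _ :=
  GRing.isSubmodClosed.Build R[i] T (opkernel_pred J) opkernel_submod.

Definition opquot : Type := Quotient.quot (opkernel_pred J).

HB.instance Definition _ := ZmodQuotient.on opquot.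

Definition quotmap (x : T) : opquot := \pi_opquot x.

Lemma quotmap_eq x y : (quotmap x == quotmap y) = (x - y \in J).
Proof. by rewrite -Quotient.idealrBE. Qed.

Lemma quotmap_repr q : quotmap (repr q) = q.
Proof. exact: reprK. Qed.

Lemma quotmap_eqP x y : quotmap x = quotmap y <-> x - y \in J.
Proof. by rewrite -quotmap_eq; split=> /eqP. Qed.

Lemma quotmapD x y : quotmap (x + y) = quotmap x + quotmap y.
Proof. by rewrite /quotmap !piE. Qed.

Definition quot_scale (a : R[i]) (q : opquot) := quotmap (a *: repr q).

Lemma quotmapZ a x : quotmap (a *: x) = quot_scale a (quotmap x).
Proof.
apply/quotmap_eqP; rewrite -scalerBr rpredZ //.
by apply/quotmap_eqP; rewrite quotmap_repr.
Qed.

Fact quot_scaleA a b q : quot_scale a (quot_scale b q) = quot_scale (a * b) q.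
Proof. by rewrite -[q]quotmap_repr -!quotmapZ scalerA. Qed.

Fact quot_scale1 : left_id 1 quot_scale.
Proof. by move=> q; rewrite -[q]quotmap_repr -!quotmapZ scale1r. Qed.

Fact quot_scaleDr : right_distributive quot_scale +%R.
Proof.
move=> a p q; rewrite -[p]quotmap_repr -[q]quotmap_repr.
by rewrite -quotmapD -!quotmapZ scalerDr quotmapD.
Qed.

Fact quot_scaleDl q : {morph quot_scale^~ q : a b / a + b}.
Proof.
by move=> a b; rewrite -[q]quotmap_repr -!quotmapZ scalerDl quotmapD.
Qed.

HB.instance Definition _ := GRing.Zmodule_isLmodule.Build R[i] opquot
  quot_scaleA quot_scale1 quot_scaleDr quot_scaleDl.

Fact quotmap_linear : linear quotmap.
Proof. by move=> a x y; rewrite quotmapD quotmapZ. Qed.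

HB.instance Definition _ :=
  GRing.isLinear.Build R[i] T opquot *:%R quotmap quotmap_linear.

Definition quot_star (q : opquot) : opquot := quotmap (star (repr q)).

(* The matrix k ranges over M_n(J). *)
Definition quot_mxpos n (A : 'M[opquot]_n) : Prop :=
  exists2 x : 'M[T]_n, A = map_mx quotmap x &
    forall r : R, 0 < r ->
      exists2 k : 'M[T]_n, forall i j, k i j \in J &
        mxpos n ((r%:C *: os_unit T)%:M + (x + k)).

Definition quot_unit : opquot := quotmap (os_unit T).

Lemma opkernel_star x : x \in J -> star x \in J.
Proof.
have [U [f [f_ucp Jf]]] := opkernelP J.
by rewrite !Jf (ucp_star f_ucp) => /eqP ->; rewrite star0.
Qed.

Lemma quotmap_star x : quotmap (star x) = quot_star (quotmap x).
Proof.
apply/quotmap_eqP; rewrite -starN -starD opkernel_star //.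
by apply/quotmap_eqP; rewrite quotmap_repr.
Qed.

Fact quot_starK : involutive quot_star.
Proof. by move=> q; rewrite -[q]quotmap_repr -!quotmap_star starK. Qed.

Fact quot_star_conjlinear a p q :
  quot_star (a *: p + q) = a^* *: quot_star p + quot_star q.
Proof.
rewrite -[p]quotmap_repr -[q]quotmap_repr -linearP -!quotmap_star -linearP.
by rewrite star_conjlinear.
Qed.

Lemma mxadj_quotmap n (x : 'M[T]_n) :
  mxadj quot_star (map_mx quotmap x) = map_mx quotmap (mxadj star x).
Proof. by apply/matrixP=> i j; rewrite !mxE quotmap_star. Qed.

Lemma mxcongr_quotmap m n (X : 'M[R[i]]_(m, n)) (x : 'M[T]_m) :
  mxcongr X (map_mx quotmap x) = map_mx quotmap (mxcongr X x).
Proof.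
apply/matrixP=> i j; rewrite !mxE linear_sum; apply: eq_bigr => k _.
by rewrite linear_sum; apply: eq_bigr => l _; rewrite !mxE linearZ.
Qed.

Lemma map_quotmap_eqP m n (x y : 'M[T]_(m, n)) :
  map_mx quotmap x = map_mx quotmap y <-> forall i j, x i j - y i j \in J.
Proof.
split=> [/matrixP e i j|e].
  by apply/quotmap_eqP; have := e i j; rewrite !mxE.
by apply/matrixP=> i j; rewrite !mxE; apply/quotmap_eqP.
Qed.

Lemma map_quotmap_repr m n (A : 'M[opquot]_(m, n)) :
  map_mx quotmap (map_mx repr A) = A.
Proof. by apply/matrixP=> i j; rewrite !mxE quotmap_repr. Qed.

Local Notation I_ r := ((r%:C *: os_unit T)%:M).

Lemma quotmap_unit_mx n (r : R) :
  map_mx quotmap (I_ r) = (r%:C *: quot_unit)%:M :> 'M_n.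
Proof.
apply/matrixP => i j; rewrite !mxE; case: eqP => _.
  by rewrite !mulr1n linearZ.
exact: linear0.
Qed.

Lemma quot_mxpos_map n (x : 'M[T]_n) :
  mxpos n x -> quot_mxpos (map_mx quotmap x).
Proof.
move=> x0; exists x => // r r0; exists 0 => [i j|].
  by rewrite mxE rpred0.
by rewrite addr0; apply: mxposD => //; exact: mxpos_unit.
Qed.

Fact quot_mxpos_adj n (A : 'M[opquot]_n) :
  quot_mxpos A -> mxadj quot_star A = A.
Proof.
case=> x -> /(_ 1 ltr01) [k kJ /(mxpos_adj _)].
rewrite !mxadjD mxadj_unit => /addrI e.
rewrite mxadj_quotmap; apply/map_quotmap_eqP => i j.
have /matrixP/(_ i j) : mxadj star x - x = k - mxadj star k.
  by apply/eqP; rewrite subr_eq addrAC [k + x]addrC -e addrK.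
by rewrite !mxE => ->; rewrite rpredB // opkernel_star.
Qed.

Fact quot_mxposD n (A B : 'M[opquot]_n) :
  quot_mxpos A -> quot_mxpos B -> quot_mxpos (A + B).
Proof.
case=> x -> xP [y -> yP]; exists (x + y); first by rewrite map_mxD.
move=> r r0; have r2 : 0 < r / 2 by rewrite divr_gt0.
have [k kJ kP] := xP _ r2; have [l lJ lP] := yP _ r2.
exists (k + l) => [i j|]; first by rewrite mxE rpredD.
by have := mxposD _ _ kP lP; rewrite addrACA -unit_mxD -splitr addrACA.
Qed.

Fact quot_mxposZ n (r : R) (A : 'M[opquot]_n) : 0 <= r ->
  quot_mxpos A -> quot_mxpos (map_mx ( *:%R r%:C) A).
Proof.
rewrite le_eqVlt => /predU1P[<- _|r0].
  have -> : map_mx ( *:%R 0%:C) A = map_mx quotmap 0.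
    by apply/matrixP => i j; rewrite !mxE scale0r linear0.
  exact/quot_mxpos_map/mxpos0.
case=> x -> xP; exists (map_mx ( *:%R r%:C) x).
  by apply/matrixP => i j; rewrite !mxE linearZ.
move=> s s0; have [k kJ kP] := xP _ (divr_gt0 s0 r0).
exists (map_mx ( *:%R r%:C) k) => [i j|]; first by rewrite mxE rpredZ.
have := mxposZ _ _ (ltW r0) kP.
by rewrite !map_mxD /= unit_mxZ mulrC divfK // gt_eqF.
Qed.

Fact quot_mxpos_proper n (A : 'M[opquot]_n) :
  quot_mxpos A -> quot_mxpos (- A) -> A = 0.
Proof.
have [U [f [[f_cp f1] Jf]]] := opkernelP J.
have fpos (x : 'M[T]_n) : (forall r : R, 0 < r ->
    exists2 k : 'M[T]_n, forall i j, k i j \in J & mxpos n (I_ r + (x + k))) ->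
    mxpos n (map_mx f x).
  move=> xP; apply: os_archimedean => r r0.
  have [k kJ /f_cp] := xP _ r0; congr mxpos.
  apply/matrixP => i j; rewrite !mxE !linearD /=.
  have /eqP -> : f (k i j) == 0 by rewrite -Jf kJ.
  rewrite addr0; congr (_ + _); case: eqP => _; last exact: linear0.
  by rewrite !mulr1n linearZ /= f1.
case=> x -> /fpos fx [y e /fpos fy].
have fyx : map_mx f y = - map_mx f x.
  apply/matrixP => i j; rewrite !mxE.
  have := congr1 (fun M : 'M_n => M i j) e; rewrite !mxE -linearN.
  move/quotmap_eqP; rewrite Jf linearB linearN subr_eq0.
  by move/eqP.
rewrite fyx in fy; have /matrixP fx0 := mxpos_proper _ fx fy.
apply/matrixP => i j; rewrite !mxE -[RHS](linear0 quotmap).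
apply/quotmap_eqP; rewrite subr0 Jf.
by have := fx0 i j; rewrite !mxE => ->.
Qed.

Fact quot_mxpos_congr m n (X : 'M[R[i]]_(m, n)) (A : 'M[opquot]_m) :
  quot_mxpos A -> quot_mxpos (mxcongr X A).
Proof.
case=> x -> xP; exists (mxcongr X x); first exact: mxcongr_quotmap.
move=> r r0; pose B : 'M[T]_n := map_mx ( *:%R (-1)%:C) (mxcongr X (I_ 1)).
have hB : mxadj star B = B.
  have /mxpos_adj/matrixP e : mxpos n (mxcongr X (I_ 1 : 'M[T]_m)).
    by apply: mxpos_congr; apply: mxpos_unit.
  apply/matrixP => i j; have := e i j.
  by rewrite !mxE starZ conj_real => ->.
have [s s0 sP] := os_order_unit _ hB.
have [k kJ kP] := xP _ (divr_gt0 r0 s0).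
exists (mxcongr X k) => [i j|].
  by rewrite mxE rpred_sum // => a _; rewrite rpred_sum // => b _; rewrite rpredZ.
have rs : 0 <= r / s by rewrite ltW // divr_gt0.
have := mxposD _ _ (mxposZ _ _ rs sP) (mxpos_congr X _ kP).
rewrite map_mxD /= unit_mxZ divfK ?gt_eqF // !mxcongrD.
rewrite -[in I_ (r / s)](mulr1 (r / s)) -unit_mxZ mxcongrZ.
have BC : map_mx ( *:%R (r / s)%:C) B +
    map_mx ( *:%R (r / s)%:C) (mxcongr X (I_ 1)) = 0.
  apply/matrixP => i j; rewrite [LHS]mxE !(mxE map_mx_key) [RHS]mxE.
  by rewrite rmorphN rmorph1 scaleN1r scalerN addNr.
by rewrite addrA -[_ + _ + map_mx _ _]addrA BC addr0.
Qed.

Fact quot_order_unit n (A : 'M[opquot]_n) : mxadj quot_star A = A ->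
  exists2 r : R, 0 < r & quot_mxpos ((r%:C *: quot_unit)%:M + A).
Proof.
move=> hA; pose x := map_mx repr A.
have xA : map_mx quotmap x = A by exact: map_quotmap_repr.
pose y := map_mx ( *:%R (2^-1)%:C) (x + mxadj star x).
have hy : mxadj star y = y.
  by apply/matrixP => i j; rewrite !mxE starZ conj_real starD starK addrC.
have [r r0 /quot_mxpos_map p] := os_order_unit _ hy; exists r => //.
suff yA : map_mx quotmap y = A by rewrite map_mxD yA quotmap_unit_mx in p.
apply/matrixP => i j; have /matrixP/(_ i j) := hA; rewrite -xA mxadj_quotmap.
rewrite !mxE linearZ linearD /= => ->.
rewrite -mulr2n -scaler_nat scalerA -(rmorph_nat (real_complex R)) -rmorphM.
by rewrite mulVf ?pnatr_eq0 // scale1r.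
Qed.

Fact quot_archimedean n (A : 'M[opquot]_n) :
  (forall r : R, 0 < r -> quot_mxpos ((r%:C *: quot_unit)%:M + A)) ->
  quot_mxpos A.
Proof.
move=> AP; exists (map_mx repr A); first by rewrite map_quotmap_repr.
set x := map_mx repr A => r r0; have r2 : 0 < r / 2 by rewrite divr_gt0.
have [y e /(_ _ r2) [k kJ kP]] := AP _ r2.
exists (y - I_ (r / 2) - x + k) => [i j|]; last first.
  rewrite [x + _]addrA [x + (_ - x)]addrC subrK [_ - _ + k]addrAC.
  rewrite [in I_ r](splitr r) unit_mxD -[_ + (y + k - _)]addrA.
  by rewrite [_ + (y + k - _)]addrC subrK.
rewrite mxE rpredD // -addrA -opprD !mxE.
have /map_quotmap_eqP/(_ i j) :
    map_mx quotmap y = map_mx quotmap (I_ (r / 2) + x).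
  by rewrite map_mxD quotmap_unit_mx map_quotmap_repr e.
by rewrite !mxE.
Qed.

Fact quot_star_unit : quot_star quot_unit = quot_unit.
Proof. by rewrite /quot_unit -quotmap_star star_unit. Qed.

Fact quot_unit_neq0 : quot_unit != 0.
Proof.
have [U [f [[_ f1] Jf]]] := opkernelP J.
by rewrite -(linear0 quotmap) quotmap_eq subr0 Jf f1 os_unit_neq0.
Qed.

HB.instance Definition _ := isOperatorSystem.Build R opquot
  quot_starK quot_star_conjlinear quot_mxpos_adj quot_mxposD quot_mxposZ
  quot_mxpos_proper quot_mxpos_congr quot_star_unit quot_order_unit
  quot_archimedean quot_unit_neq0.

End Quotient.

(* Main.v *)
Require Import Defs.
From HB Require Import structures.
From mathcomp Require Import all_boot all_order all_algebra.
From mathcomp Require Import complex reals.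
From mathcomp Require Import boolp classical_sets functions.

(** If S is one-dimensional, then S = C 1, and the linear map which sends 1
    to the unit of T lifts any unital map into T / J. A positive matrix over
    S has the form a (x) 1; by the spectral theorem a = X^* X
    ([unit_mx_pos_gram]), so a (x) 1 is positive over every operator system
    ([one_dimensional_unital_cp]).

    Otherwise some hermitian h in S is not a multiple of 1
    ([hermitian_scalar]), and there is a hermitian linear form w on S with w
    1 = 0 and w h = 1 ([separating_null_form]); it need be neither positive
    nor continuous. The shears D_c x = x - c (w x) 1 fix 1 and tend
    pointwise to the identity in the order-unit norm as c tends to 0
    ([shear_near]). Let T be the space of the eventually constant sequences
    in S, a matrix A over T being positive when D_{1/(k+1)} (A_k) is
    positive for every k. This is an operator system, the limit map T -> S
    is unital completely positive ([ev_lim_ucp]), and its kernel J consists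
    of the eventually zero sequences. Sending x to the class of its constant
    sequence is unital completely positive from S to T / J ([ev_class_ucp]),
    since the sequence of a positive matrix is positive up to epsilon from
    some rank on. If psi is a completely positive lift, then psi 1 and psi h
    are 1 and h from some rank k on. Thus h + t 1 >= 0 implies D_{1/(k+1)}
    (h + t 1) = h + t 1 - 1/(k+1) 1 >= 0, for all real t. As h + t 1 >= 0
    for some t, iteration gives it for every t, which is absurd
    ([hermitian_lift_scalar]). *)

Set Implicit Arguments.
Unset Strict Implicit.
Unset Printing Implicit Defensive.

Import Order.TTheory GRing.Theory Num.Theory.
Local Open Scope ring_scope.

Local Notation "x %:C" := (real_complex _ x) : ring_scope.

(** * Matrices over an operator system *)

Lemma scale_unit_inj (R : realType) (S : opsysType R) :
  injective ( *:%R^~ (os_unit S)).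
Proof.
move=> a b /eqP; rewrite -subr_eq0 -scalerBl scaler_eq0.
by rewrite (negPf os_unit_neq0) orbF subr_eq0 => /eqP.
Qed.

Section UnitMatrices.
Variables (R : realType) (V : opsysType R).

Local Notation e := (os_unit V).

(** The scalar matrix [a], seen in the matrices over [V] as a (x) 1. *)
Definition unit_mx n (a : 'M[R[i]]_n) : 'M[V]_n := map_mx ( *:%R^~ e) a.

Lemma unit_mx_scalar n (c : R[i]) : unit_mx c%:M = (c *: e)%:M :> 'M_n.
Proof. by apply/matrixP => i j; rewrite !mxE scalerMnl. Qed.

Lemma mxcongr_unit m n (X : 'M[R[i]]_(m, n)) (a : 'M[R[i]]_m) :
  mxcongr X (unit_mx a) = unit_mx (map_mx Num.conj X^T *m a *m X).
Proof.
apply/matrixP => i j; rewrite !mxE scaler_suml exchange_big /=.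
apply: eq_bigr => l _; rewrite !mxE mulr_suml scaler_suml.
apply: eq_bigr => k _.
by rewrite !mxE scalerA mulrAC.
Qed.

Lemma os_real_ge0 (r : R) : mxpos 1 ((r%:C *: e)%:M : 'M_1) -> 0 <= r.
Proof.
move=> rP; case: (leP 0 r) => // r0.
have : mxpos 1 (- (r%:C *: e)%:M : 'M[V]_1).
  by rewrite -raddfN -scaleNr -rmorphN; apply: mxpos_unit; rewrite oppr_gt0.
move/(mxpos_proper _ rP)/matrixP/(_ 0 0)/eqP; rewrite !mxE mulr1n scaler_eq0.
by rewrite (negPf os_unit_neq0) orbF (inj_eq (@complexI _)) (lt_eqF r0).
Qed.

Lemma unit_mx_inj n : injective (@unit_mx n).
Proof.
move=> a b /matrixP ab; apply/matrixP => i j; have := ab i j.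
by rewrite !mxE => /scale_unit_inj.
Qed.

Lemma mxpos_diag n (A : 'M[V]_n) j : mxpos n A -> mxpos 1 (A j j)%:M.
Proof.
move=> /(mxpos_congr (delta_mx j 0 : 'cV_n)); congr mxpos.
apply/matrixP => i l; rewrite !ord1 !mxE (bigD1 j) //= (bigD1 j) //= !mxE !eqxx.
rewrite rmorph1 mulr1 scale1r !big1 ?addr0 // => [k kj|k kj].
  by rewrite big1 // => m _; rewrite !mxE (negPf kj) rmorph0 mul0r scale0r.
by rewrite !mxE (negPf kj) mulr0 scale0r.
Qed.

(** A positive matrix a (x) 1 over any operator system comes from a positive
    semidefinite [a]: the spectral theorem diagonalizes [a], and the diagonal
    entries are nonnegative because the cone of [V] is proper. *)
Lemma unit_mx_pos_gram n (a : 'M[R[i]]_n) : mxpos n (unit_mx a) ->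
  exists X : 'M[R[i]]_n, a = map_mx Num.conj X^T *m X.
Proof.
move=> aP; have a_herm : a \is hermitianmx n false Num.conj.
  apply/is_hermitianmxP; rewrite expr0 scale1r; apply: unit_mx_inj.
  rewrite -[LHS](mxpos_adj _ aP); apply/matrixP => i j.
  by rewrite !mxE starZ star_unit.
have /orthomx_spectralP aE := hermitian_normalmx a_herm.
have /mxOverP d_real := hermitian_spectral_diag_real a_herm.
have P_unit := spectral_unit a; have PV := invmx_unitary (spectral_unitarymx a).
move: (spectralmx a) (spectral_diag a) => P d in aE d_real P_unit PV.
have d_ge0 j : 0 <= d 0 j.
  have /(mxpos_congr (invmx P))/(@mxpos_diag _ _ j) := aP.
  have -> : mxcongr (invmx P) (unit_mx a) = unit_mx (diag_mx d).
    (* [P] is unitary, so congruence by its inverse is conjugation by [P]. *)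
    by rewrite mxcongr_unit aE {1}PV trmxCK !mulmxA mulmxV // mul1mx mulmxK.
  rewrite !mxE eqxx mulr1n; have /CrealP := d_real 0 j.
  case: (d 0 j) => x y /= /eqP; rewrite eq_complex /= => /andP[_].
  rewrite -subr_eq0 -opprD oppr_eq0 -mulr2n mulrn_eq0 /= => /eqP ->.
  by move/os_real_ge0; rewrite lecE /= eqxx.
exists (diag_mx (map_mx sqrtC d) *m P).
rewrite trmx_mul map_mxM tr_diag_mx map_diag_mx -PV mulmxA.
rewrite -[invmx P *m _ *m _]mulmxA {1}aE mulmx_diag.
congr (_ *m diag_mx _ *m _).
apply/rowP => j; rewrite !mxE; set s := sqrtC _.
have s_real : s \is Num.real by rewrite ger0_real // sqrtC_ge0.
by rewrite -[LHS]sqrtCK expr2; congr (_ * _); apply/esym/CrealP.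
Qed.

End UnitMatrices.

(** * One-dimensional operator systems *)

Lemma unit_coord (R : realType) (S : opsysType R) :
  (forall x : S, exists c, x = c *: os_unit S) ->
  exists c : {scalar S}, forall x, x = c x *: os_unit S.
Proof.
move=> /choice[c cP].
have cL : linear_for *%R c.
  move=> a x y; apply: (@scale_unit_inj _ S); rewrite -cP scalerDl -scalerA.
  by rewrite -!cP.
pose C : {scalar S} := HB.pack c (GRing.isLinear.Build _ _ _ _ c cL).
by exists C.
Qed.

Lemma one_dimensionalP (R : realType) (S : opsysType R) :
  one_dimensional S <-> forall x : S, exists c, x = c *: os_unit S.
Proof.
split=> [[f fL f_bij] x|/unit_coord[c cP]].
  have [g fK _] := f_bij; pose F : {linear S -> 'rV_1} := HB.pack f
    (GRing.isLinear.Build _ _ _ _ f fL).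
  have Finj : injective F := can_inj fK.
  have F1 : F (os_unit S) 0 0 != 0.
    apply: contra os_unit_neq0 => /eqP F1; apply/eqP/Finj.
    by rewrite linear0; apply/rowP => j; rewrite ord1 F1 mxE.
  exists (F x 0 0 / F (os_unit S) 0 0); apply: Finj; rewrite linearZ.
  by apply/rowP => j; rewrite ord1 mxE divfK.
have cE a : c (a *: os_unit S) = a by apply: (@scale_unit_inj _ S); rewrite -cP.
exists (fun x => (c x)%:M) => [a x y|].
  by rewrite linearP raddfD /= scale_scalar_mx.
exists (fun M : 'rV_1 => M 0 0 *: os_unit S) => [x|M].
  by rewrite mxE mulr1n -cP.
by apply/rowP => j; rewrite cE ord1 mxE mulr1n.
Qed.

(** On a one-dimensional operator system, a linear map is completely positive
    as soon as it is unital. *)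
Lemma one_dimensional_unital_cp (R : realType) (S T : opsysType R)
    (f : {linear S -> T}) :
  one_dimensional S -> f (os_unit S) = os_unit T -> completely_positive f.
Proof.
move=> /one_dimensionalP/unit_coord[c cP] f1 n A.
have -> : A = unit_mx S (map_mx c A).
  by apply/matrixP => i j; rewrite !mxE -cP.
case/unit_mx_pos_gram => X ->.
have -> : map_mx f (unit_mx S (map_mx Num.conj X^T *m X)) =
          mxcongr X (unit_mx T 1%:M).
  by rewrite mxcongr_unit mulmx1; apply/matrixP => i j; rewrite !mxE linearZ f1.
by apply: mxpos_congr; rewrite unit_mx_scalar -(rmorph1 (real_complex R));
  apply: mxpos_unit.
Qed.

Lemma one_dimensional_lift (R : realType) (S T : opsysType R) (J : opkernel T)
    (phi : {linear S -> opquot J}) :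
  one_dimensional S -> phi (os_unit S) = os_unit (opquot J) ->
  exists2 psi : {linear S -> T},
    completely_positive psi & forall x, quotmap J (psi x) = phi x.
Proof.
move=> S1; have [c cP] := unit_coord ((one_dimensionalP S).1 S1).
pose f x := c x *: os_unit T => phi1.
have fL : linear f by move=> a x y; rewrite /f linearP scalerDl -scalerA.
pose psi : {linear S -> T} := HB.pack f (GRing.isLinear.Build _ _ _ _ f fL).
exists psi => [|x]; last by rewrite [in RHS](cP x) !linearZ phi1.
apply: one_dimensional_unital_cp => //; rewrite -[RHS]scale1r; congr (_ *: _).
by apply: (@scale_unit_inj _ S); rewrite -cP scale1r.
Qed.

(** * Linear forms *)

(** By Zorn's lemma there is a maximal subspace [M] containing [e] and not [h];
    maximality makes it a hyperplane, with complement the line of [h]. *)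
Lemma separating_form (K : fieldType) (V : lmodType K) (e h : V) :
  (forall c, h <> c *: e) -> exists w : {scalar V}, w e = 0 /\ w h = 1.
Proof.
move=> he; pose P (M : set V) := [/\ forall a x y, M x -> M y -> M (a *: x + y),
  ~ M h & forall x, M x -> M e].
(* The empty set satisfies [P], as the union of the empty chain must. *)
have [|M [[Mlin Mh Me0] Mmax]] := @Zorn_bigcup V P.
  move=> F FP Ftot; split=> [a x y [A FA Ax] [B FB By]|[A /FP[]]//|x [A FA Ax]].
    have [AB|BA] := Ftot A B FA FB.
      exists B => //; have [Blin _ _] := FP _ FB.
      by apply: Blin => //; exact: AB.
    by exists A => //; have [Alin _ _] := FP _ FA; apply: Alin => //; exact: BA.
  by exists A => //; have [_ _ Ae] := FP _ FA; exact: Ae Ax.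
have Me : M e.
  apply: contrapT => nMe; apply: (Mmax [set c *: e | c in [set: K]]%classic).
    split=> [x Mx|sub]; first by have := nMe (Me0 x Mx).
    by apply/nMe/sub; exists 1; rewrite ?scale1r.
  split=> [a _ _ [b _ <-] [c _ <-]|[c _ /esym/he]|_ _] //.
    by exists (a * b + c); rewrite // scalerDl scalerA.
  by exists 1; rewrite ?scale1r.
have M0 : M 0 by have := Mlin (-1) e e Me Me; rewrite scaleN1r addNr.
have MZ a x : M x -> M (a *: x).
  by move=> Mx; have := Mlin a x 0 Mx M0; rewrite addr0.
have dec x : exists c, M (x - c *: h).
  have [Mx|nMx] := pselect (M x); first by exists 0; rewrite scale0r subr0.
  pose B := [set y | exists a, M (y - a *: x)]%classic.
  have MB : (M `<=` B)%classic by move=> y My; exists 0; rewrite scale0r subr0.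
  have [[a Ma]|nBh] := pselect (B h).
    have a0 : a != 0.
      by apply: contra_not_neq Mh => a0; rewrite a0 scale0r subr0 in Ma.
    exists a^-1; have := MZ (- a^-1) _ Ma.
    by rewrite scalerBr scalerA mulNr mulVf // scaleN1r opprK addrC -scaleNr.
  have Bx : B x by exists 1; rewrite scale1r subrr.
  exfalso; apply: (Mmax B); first by split=> // /(_ x Bx).
  split=> // [a y z [b My] [c Mz]|y _]; last exact: MB.
  exists (a * b + c); have := Mlin a _ _ My Mz.
  by rewrite scalerBr scalerA addrACA -opprD -scalerDl.
have uniq c d x : M (x - c *: h) -> M (x - d *: h) -> c = d.
  move=> Mc Md; apply/eqP; rewrite -subr_eq0; apply: contra_notT Mh => cd.
  have := MZ (c - d)^-1 _ (Mlin (-1) _ _ Mc Md).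
  rewrite scaleN1r opprB addrA subrK -scalerBl.
  by rewrite scalerA mulVf // scale1r.
have [w wP] := choice dec.
have wL : linear_for *%R w.
  move=> a x y; apply: (uniq _ _ (a *: x + y)) => //.
  have := Mlin a _ _ (wP x) (wP y).
  by rewrite scalerBr scalerA addrACA -opprD -scalerDl.
pose W : {scalar V} := HB.pack w (GRing.isLinear.Build _ _ _ _ w wL).
exists W; split.
  by apply: (uniq _ _ e) => //=; rewrite scale0r subr0.
by apply: (uniq _ _ h) => //=; rewrite scale1r subrr.
Qed.

Lemma hermitian_scalar (R : realType) (S : opsysType R) :
  (forall h : S, star h = h -> exists c, h = c *: os_unit S) ->
  forall x : S, exists c, x = c *: os_unit S.
Proof.
move=> herm x; have [|a aP] := herm (x + star x).
  by rewrite starD starK addrC.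
have [|b bP] := herm ('i%C *: (x - star x)).
  have iN : 'i%C^* = - 'i%C :> R[i].
    by apply/eqP; rewrite eq_complex /= oppr0 !eqxx.
  by rewrite starZ starD starN starK iN scaleNr -scalerN opprB.
(* Twice [x] is (x + x^* ) - i (i (x - x^* )). *)
exists (2^-1 * (a - 'i%C * b)).
have ii : 'i%C * 'i = -1 :> R[i] by have := sqr_i R; rewrite expr2.
have iS (y : S) : 'i%C *: ('i%C *: y) = - y by rewrite scalerA ii scaleN1r.
rewrite -scalerA scalerBl -scalerA -aP -bP iS opprK addrACA subrr addr0.
have two0 : (2 : R[i]) != 0 by rewrite pnatr_eq0.
transitivity (2^-1 *: (2 *: x)); first by rewrite scalerA mulVf // scale1r.
by rewrite scaler_nat mulr2n.
Qed.

(** A hermitian linear form vanishing at the unit; no positivity is asked. *)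
Record null_form (R : realType) (S : opsysType R) := NullForm {
  null_form_val :> {scalar S};
  null_form_star : forall x, null_form_val (star x) = (null_form_val x)^*;
  null_form_unit : null_form_val (os_unit S) = 0
}.

Lemma separating_null_form (R : realType) (S : opsysType R) (h : S) :
  star h = h -> (forall c, h <> c *: os_unit S) ->
  exists w : null_form S, w h = 1.
Proof.
move=> hh /separating_form[v [v1 vh]].
pose w x := 2^-1 * (v x + (v (star x))^*).
have wL : linear_for *%R w.
  move=> a x y; rewrite /w star_conjlinear !linearP rmorphD rmorphM /= conjCK.
  transitivity (2^-1 * (a * (v x + (v (star x))^*) + (v y + (v (star y))^*))).
    by rewrite (mulrDr a) addrACA.
  by rewrite mulrDr mulrCA.
pose W : {scalar S} := HB.pack w (GRing.isLinear.Build _ _ _ _ w wL).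
have W_star x : W (star x) = (W x)^*.
  by rewrite /= /w starK rmorphM rmorphD /= conjCK fmorphV rmorph_nat addrC.
have W1 : W (os_unit S) = 0 by rewrite /= /w star_unit v1 rmorph0 addr0 mulr0.
exists (NullForm W_star W1) => /=.
by rewrite /w hh vh rmorph1 mulVf // pnatr_eq0.
Qed.

(** * The shears of an operator system *)

Lemma mxcongr_map (R : realType) (V W : lmodType R[i]) (f : {linear V -> W})
    m n (X : 'M[R[i]]_(m, n)) (A : 'M[V]_m) :
  map_mx f (mxcongr X A) = mxcongr X (map_mx f A).
Proof.
apply/matrixP => i j; rewrite !mxE linear_sum; apply: eq_bigr => k _.
by rewrite linear_sum; apply: eq_bigr => l _; rewrite !mxE linearZ.
Qed.

Lemma map_mx_scalar (U V : nmodType) (f : {additive U -> V}) n (x : U) :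
  map_mx f (x%:M : 'M_n) = (f x)%:M.
Proof. by apply/matrixP => i j; rewrite !mxE raddfMn. Qed.

Lemma map_mxZ (K : pzRingType) (U V : lmodType K) (f : {linear U -> V}) m n
    (a : K) (A : 'M[U]_(m, n)) :
  map_mx f (map_mx ( *:%R a) A) = map_mx ( *:%R a) (map_mx f A).
Proof. by apply/matrixP => i j; rewrite !mxE linearZ. Qed.

Lemma mxpos_le_unit (R : realType) (V : opsysType R) n (r s : R) (A : 'M[V]_n) :
  r <= s -> mxpos n ((r%:C *: os_unit V)%:M + A) ->
  mxpos n ((s%:C *: os_unit V)%:M + A).
Proof.
move=> rs rP; rewrite -(subrK r s) unit_mxD -addrA; apply: mxposD => //.
move: rs; rewrite -subr_ge0 le_eqVlt => /predU1P[<-|]; last exact: mxpos_unit.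
by rewrite rmorph0 scale0r raddf0; apply: mxpos0.
Qed.

Lemma invS_mul_le (R : realType) (s r : R) k :
  0 < r -> (Num.truncn (s / r) <= k)%N -> k.+1%:R^-1 * s <= r.
Proof.
move=> r0 sk; rewrite mulrC ler_pdivrMr // -ler_pdivrMl // mulrC ltW //.
by apply: lt_le_trans (truncnS_gt _) _; rewrite ler_nat ltnS.
Qed.

Section Shear.
Variables (R : realType) (S : opsysType R) (w : null_form S).

(** The linear map D_c : x |-> x - c (w x) 1. *)
Definition shear (c : R) (x : S) : S := x - (c%:C * w x) *: os_unit S.

Fact shear_linear c : linear (shear c).
Proof.
move=> a x y; have cw : c%:C * w (a *: x + y) = a * (c%:C * w x) + c%:C * w y.
  by rewrite linearP mulrDr mulrCA.
by rewrite /shear cw scalerDl scalerBr scalerA opprD addrACA.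
Qed.

HB.instance Definition _ c :=
  GRing.isLinear.Build R[i] S S *:%R (shear c) (shear_linear c).

Lemma shear_star c x : shear c (star x) = star (shear c x).
Proof.
have cw : (c%:C * w x)^* = c%:C * (w x)^*.
  by rewrite rmorphM; congr (_ * _); exact: conj_real.
by rewrite /shear starD starN starZ star_unit null_form_star cw.
Qed.

Lemma shear_unit c : shear c (os_unit S) = os_unit S.
Proof. by rewrite /shear null_form_unit mulr0 scale0r subr0. Qed.

(** The form is invariant under the shears, since it vanishes at the unit. *)
Lemma null_form_shear c x : w (shear c x) = w x.
Proof. by rewrite /shear linearB linearZ /= null_form_unit mulr0 subr0. Qed.

Lemma shear_inj c : injective (shear c).
Proof.
move=> x y xy; have wxy : w x = w y.
  by rewrite -(null_form_shear c) xy null_form_shear.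
by move: xy; rewrite /shear wxy => /addIr.
Qed.

(** The shears tend pointwise to the identity in the order-unit norm, at a rate
    linear in [c]. *)
Lemma shear_near n (A : 'M[S]_n) : mxadj star A = A ->
  exists2 r : R, 0 < r & forall c : R, 0 <= c ->
    mxpos n (((c * r)%:C *: os_unit S)%:M + (map_mx (shear c) A - A)) /\
    mxpos n (((c * r)%:C *: os_unit S)%:M + (A - map_mx (shear c) A)).
Proof.
move=> hA; pose Z : 'M[S]_n := \matrix_(i, j) (w (A i j) *: os_unit S).
have hZ : mxadj star Z = Z.
  apply/matrixP => i j; rewrite !mxE starZ star_unit -null_form_star.
  by have /matrixP/(_ i j) := hA; rewrite !mxE => ->.
have hNZ : mxadj star (- Z) = - Z.
  by rewrite -[in RHS]hZ; apply/matrixP => i j; rewrite !mxE starN.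
have [r r0 rP] := os_order_unit _ hZ; have [s s0 sP] := os_order_unit _ hNZ.
have AZ c : map_mx (shear c) A = A - map_mx ( *:%R c%:C) Z.
  by apply/matrixP => i j; rewrite !mxE /shear scalerA.
have rs : r <= r + s /\ s <= r + s by rewrite lerDl lerDr !ltW.
exists (r + s) => [|c c0]; first exact: addr_gt0.
rewrite AZ [in X in _ /\ X]opprB [A + (_ - A)]addrCA subrr addr0.
rewrite [A - _ - A]addrAC subrr add0r.
have cN (B : 'M[S]_n) : - map_mx ( *:%R c%:C) B = map_mx ( *:%R c%:C) (- B).
  by apply/matrixP => i j; rewrite !mxE scalerN.
rewrite cN -unit_mxZ -!map_mxD.
split; apply: mxposZ => //; [move: sP|move: rP]; apply: mxpos_le_unit;
  by case: rs.
Qed.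

End Shear.

(** * Eventually constant sequences with sheared cones *)

(** Eventual constancy; membership is boolean so as to define a subtype. *)
Definition ev_constant (V : Type) : {pred nat -> V} :=
  fun f => `[< exists s N, forall k, (N <= k)%N -> f k = s >].

Fact ev_constant_submod (K : pzRingType) (V : lmodType K) :
  submod_closed (@ev_constant V).
Proof.
split=> [|a f g /asboolP[s [M fs]] /asboolP[t [N gt]]]; apply/asboolP.
  by exists 0, 0%N.
exists (a *: s + t), (maxn M N) => k; rewrite geq_max => /andP[Mk Nk].
by rewrite -(fs k Mk) -(gt k Nk).
Qed.

HB.instance Definition _ (K : pzRingType) (V : lmodType K) :=
  GRing.isSubmodClosed.Build K (nat -> V) (@ev_constant V)
    (@ev_constant_submod K V).

(** The space of the eventually constant sequences in [S]. The parameter [w]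
    only enters in the cones. *)
Record evseq (R : realType) (S : opsysType R) (w : null_form S) := EvSeq {
  ev_val :> nat -> S;
  ev_valP : ev_val \in @ev_constant S
}.

Section EvSeq.
Variables (R : realType) (S : opsysType R) (w : null_form S).

HB.instance Definition _ := [isSub for @ev_val R S w].
HB.instance Definition _ := [Choice of evseq w by <:].
HB.instance Definition _ := [SubChoice_isSubLmodule of evseq w by <:].

Local Notation T := (evseq w).

(** The [k]-th coordinate sheared by 1 / (k + 1). *)
Definition ev_eval k (f : T) : S := shear w k.+1%:R^-1 (ev_val f k).

Fact ev_eval_linear k : linear (ev_eval k).
Proof. by move=> a f g; rewrite /ev_eval -linearP. Qed.

HB.instance Definition _ k :=
  GRing.isLinear.Build R[i] T S *:%R (ev_eval k) (ev_eval_linear k).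

Lemma ev_eval_inj f g : (forall k, ev_eval k f = ev_eval k g) -> f = g.
Proof.
by move=> fg; apply/val_inj/funext => k; exact: (shear_inj (fg k)).
Qed.

Lemma ev_evalmx_inj m n (A B : 'M[T]_(m, n)) :
  (forall k, map_mx (ev_eval k) A = map_mx (ev_eval k) B) -> A = B.
Proof.
move=> AB; apply/matrixP => i j; apply: ev_eval_inj => k.
by have /matrixP/(_ i j) := AB k; rewrite !mxE.
Qed.

Fact ev_star_subproof (f : T) : (fun k => star (f k)) \in @ev_constant S.
Proof.
have /asboolP[s [N fs]] := ev_valP f.
by apply/asboolP; exists (star s), N => k /fs ->.
Qed.

(** The involution is taken coordinatewise. *)
Definition ev_star (f : T) : T := EvSeq w (ev_star_subproof f).

Fact ev_cst_subproof (x : S) : (fun=> x) \in @ev_constant S.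
Proof. by apply/asboolP; exists x, 0%N. Qed.

(** The constant sequence of [x]. *)
Definition ev_cst (x : S) : T := EvSeq w (ev_cst_subproof x).

Fact ev_cst_linear : linear ev_cst.
Proof. by move=> a x y; apply/val_inj. Qed.

HB.instance Definition _ :=
  GRing.isLinear.Build R[i] S T *:%R ev_cst ev_cst_linear.

(** A matrix is positive when all its sheared coordinates are. *)
Definition ev_mxpos n (A : 'M[T]_n) : Prop :=
  forall k, mxpos n (map_mx (ev_eval k) A).

(** The constant sequence of the unit, which the shears fix. *)
Definition ev_unit : T := ev_cst (os_unit S).

Lemma ev_eval_star k f : ev_eval k (ev_star f) = star (ev_eval k f).
Proof. exact: shear_star. Qed.

Lemma ev_eval_unit k : ev_eval k ev_unit = os_unit S.
Proof. exact: shear_unit. Qed.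

Lemma ev_evalmx_adj k n (A : 'M[T]_n) :
  map_mx (ev_eval k) (mxadj ev_star A) = mxadj star (map_mx (ev_eval k) A).
Proof. by apply/matrixP => i j; rewrite !mxE ev_eval_star. Qed.

Lemma ev_evalmx_unit k n (r : R) (A : 'M[T]_n) :
  map_mx (ev_eval k) ((r%:C *: ev_unit)%:M + A) =
  (r%:C *: os_unit S)%:M + map_mx (ev_eval k) A.
Proof. by rewrite map_mxD map_mx_scalar /= linearZ /= ev_eval_unit. Qed.

(** The entries of a matrix of sequences are constant from a common rank on. *)
Lemma ev_tail n (A : 'M[T]_n) : exists N (L : 'M[S]_n),
  forall k, (N <= k)%N -> map_mx (fun f : T => f k) A = L.
Proof.
have /choice[s sP] : forall ij : 'I_n * 'I_n, exists sN : S * nat,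
    forall k, (sN.2 <= k)%N -> A ij.1 ij.2 k = sN.1.
  by move=> ij; have /asboolP[s [N sP]] := ev_valP (A ij.1 ij.2); exists (s, N).
exists (\max_ij (s ij).2), (\matrix_(i, j) (s (i, j)).1) => k Nk.
apply/matrixP => i j; rewrite !mxE; apply: (sP (i, j)).
by apply: leq_trans Nk; apply: leq_bigmax.
Qed.

Fact ev_starK : involutive ev_star.
Proof. by move=> f; apply: ev_eval_inj => k; rewrite !ev_eval_star starK. Qed.

Fact ev_star_conjlinear a f g :
  ev_star (a *: f + g) = a^* *: ev_star f + ev_star g.
Proof.
apply: ev_eval_inj => k.
by rewrite ev_eval_star linearP star_conjlinear -!ev_eval_star -linearP.
Qed.

Fact ev_mxpos_adj n (A : 'M[T]_n) : ev_mxpos A -> mxadj ev_star A = A.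
Proof.
move=> AP; apply: ev_evalmx_inj => k.
by rewrite ev_evalmx_adj (mxpos_adj _ (AP k)).
Qed.

Fact ev_mxposD n (A B : 'M[T]_n) : ev_mxpos A -> ev_mxpos B -> ev_mxpos (A + B).
Proof. by move=> AP BP k; rewrite map_mxD; exact: mxposD (AP k) (BP k). Qed.

Fact ev_mxposZ n (r : R) (A : 'M[T]_n) : 0 <= r ->
  ev_mxpos A -> ev_mxpos (map_mx ( *:%R r%:C) A).
Proof. by move=> r0 AP k; rewrite map_mxZ; exact: mxposZ r0 (AP k). Qed.

Fact ev_mxpos_proper n (A : 'M[T]_n) : ev_mxpos A -> ev_mxpos (- A) -> A = 0.
Proof.
move=> AP NP; apply: ev_evalmx_inj => k; rewrite map_mx0.
by apply: mxpos_proper (AP k) _; have := NP k; rewrite map_mxN.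
Qed.

Fact ev_mxpos_congr m n (X : 'M[R[i]]_(m, n)) (A : 'M[T]_m) :
  ev_mxpos A -> ev_mxpos (mxcongr X A).
Proof. by move=> AP k; rewrite mxcongr_map; exact: mxpos_congr (AP k). Qed.

Fact ev_star_unit : ev_star ev_unit = ev_unit.
Proof.
by apply: ev_eval_inj => k; rewrite ev_eval_star ev_eval_unit star_unit.
Qed.

(** The shears involved have parameter at most 1, so that one multiple of the
    unit suits the whole constant tail; the other ranks are finitely many. *)
Fact ev_order_unit n (A : 'M[T]_n) : mxadj ev_star A = A ->
  exists2 r : R, 0 < r & ev_mxpos ((r%:C *: ev_unit)%:M + A).
Proof.
move=> hA.
have hk k : mxadj star (map_mx (ev_eval k) A) = map_mx (ev_eval k) A.
  by rewrite -ev_evalmx_adj hA.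
have [N [L LP]] := ev_tail A.
have evL k : (N <= k)%N -> map_mx (ev_eval k) A = map_mx (shear w k.+1%:R^-1) L.
  by move=> Nk; rewrite -(LP k Nk); apply/matrixP => i j; rewrite !mxE.
have hL : mxadj star L = L.
  rewrite -(LP N) //; apply/matrixP => i j; rewrite !mxE.
  by have /matrixP/(_ i j) := hA; rewrite mxE => <-.
have [r r0 tail] : exists2 r : R, 0 < r & forall k, (N <= k)%N ->
    mxpos n ((r%:C *: os_unit S)%:M + map_mx (ev_eval k) A).
  have [r r0 rP] := os_order_unit _ hL; have [s s0 sP] := shear_near w hL.
  exists (r + s) => [|k Nk]; first exact: addr_gt0.
  have k0 : 0 <= k.+1%:R^-1 :> R by rewrite invr_ge0.
  apply: (@mxpos_le_unit _ _ _ (r + k.+1%:R^-1 * s)).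
    by rewrite lerD2l ler_piMl ?(ltW s0) // invf_le1 // ler1n.
  have [+ _] := sP _ k0; move/(mxposD _ _ rP).
  by rewrite addrACA -unit_mxD evL // (addrC L) subrK.
have [s s0 sP] : exists2 s : R, 0 < s & forall k, (k < N)%N ->
    mxpos n ((s%:C *: os_unit S)%:M + map_mx (ev_eval k) A).
  elim: (N) => [|M [s s0 sP]]; first by exists 1.
  have [t t0 tP] := os_order_unit _ (hk M); exists (s + t).
    exact: addr_gt0.
  move=> k; rewrite ltnS leq_eqVlt => /predU1P[->|kM].
    by apply: mxpos_le_unit tP; rewrite lerDr ltW.
  by apply: mxpos_le_unit (sP k kM); rewrite lerDl ltW.
exists (r + s) => [|k]; first exact: addr_gt0.
rewrite ev_evalmx_unit; have [Nk|kN] := leqP N k.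
  by apply: mxpos_le_unit (tail k Nk); rewrite lerDl ltW.
by apply: mxpos_le_unit (sP k kN); rewrite lerDr ltW.
Qed.

Fact ev_archimedean n (A : 'M[T]_n) :
  (forall r : R, 0 < r -> ev_mxpos ((r%:C *: ev_unit)%:M + A)) -> ev_mxpos A.
Proof.
move=> AP k; apply: os_archimedean => r r0.
by have := AP r r0 k; rewrite ev_evalmx_unit.
Qed.

Fact ev_unit_neq0 : ev_unit != 0.
Proof.
apply: contra_neq (os_unit_neq0 : os_unit S != 0) => e0.
by rewrite -(ev_eval_unit 0) e0 linear0.
Qed.

HB.instance Definition _ := isOperatorSystem.Build R T
  ev_starK ev_star_conjlinear ev_mxpos_adj ev_mxposD ev_mxposZ
  ev_mxpos_proper ev_mxpos_congr ev_star_unit ev_order_unit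
  ev_archimedean ev_unit_neq0.

(** ** The limit map and its kernel *)

(** The eventual value of a sequence. *)
Definition ev_lim (f : T) : S := projT1 (cid (asboolW (ev_valP f))).

Lemma ev_limP (f : T) : exists N, forall k, (N <= k)%N -> f k = ev_lim f.
Proof. exact: projT2 (cid (asboolW (ev_valP f))). Qed.

Lemma ev_limE (f : T) s N : (forall k, (N <= k)%N -> f k = s) -> ev_lim f = s.
Proof.
move=> fs; have [M fl] := ev_limP f.
by rewrite -(fl (maxn M N)) ?leq_maxl // fs // leq_maxr.
Qed.

Fact ev_lim_linear : linear ev_lim.
Proof.
move=> a f g; have [M fM] := ev_limP f; have [N gN] := ev_limP g.
apply: (@ev_limE _ _ (maxn M N)) => k; rewrite geq_max => /andP[Mk Nk].
by rewrite -(fM k Mk) -(gN k Nk).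
Qed.

HB.instance Definition _ :=
  GRing.isLinear.Build R[i] T S *:%R ev_lim ev_lim_linear.

(** The limit is completely positive because the shears tend to the identity
    and [S] is Archimedean. *)
Lemma ev_lim_ucp : ucp ev_lim.
Proof.
split=> [n A AP|]; last exact: (@ev_limE _ _ 0%N).
have [N [L LP]] := ev_tail A.
have -> : map_mx ev_lim A = L.
  apply/matrixP => i j; rewrite mxE; apply: (@ev_limE _ _ N) => k /LP <-.
  by rewrite mxE.
have hL : mxadj star L = L.
  rewrite -(LP N) //; apply/matrixP => i j; rewrite !mxE.
  by have /matrixP/(_ i j) := mxpos_adj _ AP; rewrite mxE => <-.
have [s s0 sP] := shear_near w hL; apply: os_archimedean => r r0.
pose k := maxn N (Num.truncn (s / r)).
have k0 : 0 <= k.+1%:R^-1 :> R by rewrite invr_ge0.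
apply: (@mxpos_le_unit _ _ _ (k.+1%:R^-1 * s)).
  by rewrite invS_mul_le // leq_maxr.
have [_ /mxposD/(_ (AP k))] := sP _ k0; congr mxpos.
rewrite -addrA; congr (_ + _).
have -> : map_mx (ev_eval k) A = map_mx (shear w k.+1%:R^-1) L.
  by rewrite -(LP k) ?leq_maxl //; apply/matrixP => i j; rewrite !mxE.
by rewrite subrK.
Qed.

Fact ev_null_subproof : exists (U : opsysType R) (f : {linear T -> U}),
  ucp f /\ forall x, (x \in [pred y | ev_lim y == 0]) = (f x == 0).
Proof. by exists S, ev_lim; split=> [|x]; [exact: ev_lim_ucp|rewrite inE]. Qed.

(** The eventually zero sequences, as the kernel of the limit map. *)
Definition ev_null : opkernel T := OpKernel ev_null_subproof.

(** The class of the constant sequence of [x]. *)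
Definition ev_class (x : S) : opquot ev_null := quotmap ev_null (ev_cst x).

Fact ev_class_linear : linear ev_class.
Proof. by move=> a x y; rewrite /ev_class !linearP. Qed.

HB.instance Definition _ :=
  GRing.isLinear.Build R[i] S (opquot ev_null) *:%R ev_class ev_class_linear.

Fact ev_head_subproof N (x : S) :
  (fun k => if (k < N)%N then x else 0) \in @ev_constant S.
Proof. by apply/asboolP; exists 0, N => k; rewrite leqNgt => /negPf ->. Qed.

(** The sequence with value [x] below rank [N], and zero from [N] on. *)
Definition ev_head N (x : S) : T := EvSeq w (ev_head_subproof N x).

Lemma ev_head_null N x : ev_head N x \in ev_null.
Proof.
rewrite inE /=; apply/eqP/(@ev_limE _ _ N) => k Nk.
by rewrite /= ltnNge Nk.
Qed.

(** A positive matrix becomes positive up to epsilon along the tail of its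
    constant sequence, and the kernel absorbs the first coordinates. *)
Lemma ev_class_ucp : ucp ev_class.
Proof.
split=> // n A AP; exists (map_mx ev_cst A); first by rewrite -map_mx_comp.
have [s s0 sP] := shear_near w (mxpos_adj _ AP).
move=> r r0; pose N := Num.truncn (s / r).
exists (map_mx (fun x => ev_head N (- x)) A) => [i j|k].
  by rewrite mxE ev_head_null.
rewrite ev_evalmx_unit; set B := map_mx (ev_eval k) _.
have [kN|Nk] := ltnP k N.
  have -> : B = 0.
    apply/matrixP => i j; rewrite !mxE linearD /= /ev_eval /= kN -linearD.
    by rewrite subrr linear0.
  by rewrite addr0; apply: mxpos_unit.
have -> : B = map_mx (shear w k.+1%:R^-1) A.
  apply/matrixP => i j; rewrite !mxE linearD /= /ev_eval /= ltnNge Nk /=.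
  by rewrite linear0 addr0.
have k0 : 0 <= k.+1%:R^-1 :> R by rewrite invr_ge0.
apply: (@mxpos_le_unit _ _ _ (k.+1%:R^-1 * s)); first by rewrite invS_mul_le.
have [+ _] := sP _ k0; move/mxposD/(_ AP).
by rewrite -addrA subrK.
Qed.

End EvSeq.

(** * Scalarity from lifting *)

(** A lift of [ev_class] agrees at some rank with the constant sequences of
    [h] and of the unit, whence h + t >= 0 implies h + t - c >= 0 for a fixed
    c > 0 and every real t. Since h + t >= 0 for some t, iteration gives
    arbitrarily negative such t, which -h + r0 >= 0 excludes. *)
Lemma hermitian_lift_scalar (R : realType) (S : opsysType R) (h : S) :
  (forall w : null_form S, exists2 psi : {linear S -> evseq w},
    completely_positive psi & forall x, quotmap _ (psi x) = ev_class w x) ->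
  star h = h -> exists c, h = c *: os_unit S.
Proof.
move=> lifts hh; apply: contrapT => /forallNP nh.
have [w wh] := separating_null_form hh nh; have [psi psi_cp psiP] := lifts w.
have near_cst x : exists N, forall k, (N <= k)%N -> psi x k = x.
  have /quotmap_eqP := psiP x; rewrite inE /= => /eqP l0.
  have [N NP] := ev_limP (psi x - ev_cst w x); exists N => k /NP.
  by rewrite l0 => /eqP; rewrite subr_eq0 => /eqP.
have [M hM] := near_cst h; have [N oneN] := near_cst (os_unit S).
pose k := maxn M N; pose c : R := k.+1%:R^-1.
have c0 : 0 < c by rewrite invr_gt0.
pose pos t := mxpos 1 ((t%:C *: os_unit S)%:M + h%:M : 'M[S]_1).
have step t : pos t -> pos (t - c).
  rewrite /pos -raddfD => /psi_cp/(_ k); rewrite !map_mx_scalar -raddfD.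
  congr (mxpos 1 _%:M).
  have psi_k : psi (t%:C *: os_unit S + h) k = t%:C *: os_unit S + h.
    transitivity (t%:C *: psi (os_unit S) k + psi h k).
      by rewrite linearD linearZ.
    by rewrite oneN ?leq_maxr // hM ?leq_maxl.
  rewrite /= /ev_eval psi_k linearD linearZ /= shear_unit {1}/shear wh mulr1.
  by rewrite rmorphB scalerBl addrA addrAC.
have [t0 _ t0P] : exists2 r : R, 0 < r & pos r.
  by apply: os_order_unit; apply/matrixP => i j; rewrite !mxE !ord1 !mulr1n.
have [r0 _ r0P] : exists2 r : R, 0 < r &
    mxpos 1 ((r%:C *: os_unit S)%:M + (- h)%:M : 'M[S]_1).
  apply: os_order_unit; apply/matrixP => i j.
  by rewrite !mxE !ord1 !mulr1n starN hh.
have steps m : pos (t0 - m%:R * c).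
  elim: m => [|m /step]; first by rewrite mul0r subr0.
  by rewrite -addrA -opprD -natr1 mulrDl mul1r.
have bound t : pos t -> - r0 <= t.
  move=> /(mxposD _ _ r0P); rewrite addrACA -unit_mxD -[(- h)%:M + _]raddfD.
  rewrite addNr raddf0 addr0 => /os_real_ge0 rt.
  by rewrite -subr_ge0 opprK addrC.
have := bound _ (steps (Num.truncn ((t0 + r0) / c)).+1).
rewrite lerNl opprB lerBlDr -ler_pdivlMr // leNgt.
by rewrite [r0 + t0]addrC truncnS_gt.
Qed.

Theorem proposition5p1 (R : realType) (S : opsysType R) :
  one_dimensional S <->
  forall (T : opsysType R) (J : opkernel T) (phi : {linear S -> opquot J}),
    ucp phi ->
    exists2 psi : {linear S -> T},
      completely_positive psi & forall x : S, quotmap J (psi x) = phi x.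
Proof.
split=> [S1 T J phi [_ phi1]|lift]; first exact: one_dimensional_lift.
apply/one_dimensionalP/hermitian_scalar => h; apply: hermitian_lift_scalar => w.
exact: (lift _ _ (ev_class w)) (ev_class_ucp w).
Qed.
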